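(* Let $H$ be a Hilbert space of analytic functions on the open unit disk $\mathbb{D}$ that contains all the polynomials. Let $\psi$ be analytic on $\mathbb{D}$ and $\varphi$ an analytic self-map of $\mathbb{D}$, and suppose that $C_{\psi,\varphi}$ is a normal operator on $H$. The following statements are equivalent. (a) The operator $C_{\psi,\varphi}$ is bounded below. (b) The operator $C_{\psi,\varphi}$ is Fredholm. (c) The operator $C_{\psi,\varphi}$ is invertible.
   Context: $C_{\psi,\varphi}f=\psi\cdot(f\circ\varphi)$. A bounded operator $T$ on $H$ is normal if $TT^*=T^*T$; it is bounded below if there is $c>0$ with $c\|h\|\le\|Th\|$ for all $h\in H$; it is Fredholm if it is invertible modulo the compact operators. *)

(* Defs.v *)
From HB Require Import structures.
From mathcomp Require Import all_boot all_order all_algebra.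
From mathcomp Require Import complex.
From mathcomp Require Import all_classical all_reals all_analysis.

Set Implicit Arguments.
Unset Strict Implicit.
Unset Printing Implicit Defensive.

Import Order.TTheory GRing.Theory Num.Theory.
Import numFieldNormedType.Exports.

Local Open Scope classical_set_scope.
Local Open Scope ring_scope.
Local Open Scope complex_scope.

Definition disk (R : realType) : Type := {z : R[i] | `|z| < 1}.

(* Local power series.  The radius [r] is a complex number, but the order of
   [R[i]] makes [0 < r] imply that it is real; likewise for the constants of
   [bounded_operator] and [bounded_below]. *)
Definition analytic (R : realType) (f : disk R -> R[i]) : Prop :=
  forall w : disk R, exists (a : nat -> R[i]) (r : R[i]), 0 < r /\
    forall z : disk R, `|val z - val w| < r ->
      (fun N => \sum_(0 <= n < N) a n * (val z - val w) ^+ n : R[i]^o) @ \oo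
        --> (f z : R[i]^o).

(* Functions on the disk are compared through [ev]: a point of the carrier is
   identified with the function it evaluates to.  Point evaluations are not
   assumed to be bounded. *)
Record analytic_hilbert_space (R : realType) := AnalyticHilbertSpace {
  ahs_carrier :> completeNormedModType R[i];
  dot : {dot ahs_carrier for Num.conj};
  dotE : forall h : ahs_carrier, `|h| ^+ 2 = dot h h;
  ev : {linear ahs_carrier -> (disk R -> R[i]^o)};
  ev_inj : injective ev;
  ev_analytic : forall h : ahs_carrier, analytic (ev h)
}.

Arguments dot {R} _.
Arguments ev {R} _.

Definition contains_polynomials (R : realType) (H : analytic_hilbert_space R) :
    Prop :=
  forall p : {poly R[i]}, exists h : H, ev H h = (fun z => p.[val z]).

Definition wcomp (R : realType) (psi : disk R -> R[i]) (phi : disk R -> disk R)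
  (f : disk R -> R[i]) : disk R -> R[i] := fun z => psi z * f (phi z).

Section Operators.
Context (R : realType) (H : analytic_hilbert_space R).
Implicit Types S T K : {linear H -> H}.

Definition bounded_operator T : Prop :=
  exists M : R[i], forall h : H, `|T h| <= M * `|h|.

Definition is_wcomp psi phi T : Prop :=
  forall h : H, ev H (T h) = wcomp psi phi (ev H h).

Definition is_adjoint T S : Prop :=
  forall x y : H, dot H (T x) y = dot H x (S y).

(* An operator has at most one adjoint, so [S] below is the adjoint of [T]. *)
Definition normal_operator T : Prop :=
  bounded_operator T /\
  exists S, bounded_operator S /\ is_adjoint T S /\
    forall h : H, T (S h) = S (T h).

Definition bounded_below T : Prop :=
  exists c : R[i], 0 < c /\ forall h : H, c * `|h| <= `|T h|.

Definition compact_operator K : Prop :=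
  compact (closure (K @` [set h : H | `|h| <= 1])).

Definition fredholm T : Prop :=
  exists S, bounded_operator S /\
    compact_operator (S \o T \- idfun) /\ compact_operator (T \o S \- idfun).

Definition invertible T : Prop :=
  exists S, bounded_operator S /\ cancel T S /\ cancel S T.

End Operators.

(* Main.v *)
Require Import Defs.
From HB Require Import structures.
From mathcomp Require Import all_boot all_order all_algebra.
From mathcomp Require Import complex.
From mathcomp Require Import all_classical all_reals all_analysis.
From mathcomp Require Import ring.

Set Implicit Arguments.
Unset Strict Implicit.
Unset Printing Implicit Defensive.

Import Order.TTheory GRing.Theory Num.Theory.
Import numFieldNormedType.Exports.

Local Open Scope classical_set_scope.
Local Open Scope ring_scope.
Local Open Scope complex_scope.

(** Bounded below implies invertible, for every normal operator.  Let
    [A = S \o T], where [S] is the adjoint of [T].  Since [dot x (A x) =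
    |T x|^2 >= c^2 |x|^2], the operator [A] is coercive, so [1 - t A] is a
    strict contraction for a small [t > 0] and the Neumann iteration solves
    [A x = y] ([neumann_solve], [coercive_onto]).  Normality rewrites
    [S (T x) = y] as [T (S x) = y]; hence [T] is onto, and it is injective
    because it is bounded below ([bounded_below_invertible]).

    Invertible implies Fredholm trivially: the two remainders are zero.

    Fredholm implies bounded below is where the analytic functions come in.
    If [S \o T - 1] is compact, for some bounded [S], and [T] is injective,
    then [T] is bounded below, because a sequence of unit vectors [u n] with
    [T (u n)] tending to [0] would accumulate at a nonzero vector of the kernel
    ([fredholm_injective_bounded_below]).  So suppose that [T h = 0], that is,
    [psi z * h (phi z) = 0] on the disk.  Zeros of analytic functions that are
    not identically zero are isolated.  If neither [psi] nor [h] is identically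
    zero, then near the origin [psi] is nonzero off the origin, so [phi] takes
    there values that are zeros of [h] close to [phi 0], hence equal to [phi 0]:
    [phi] is constant near the origin, and therefore constant ([wcomp_eq0]).
    It remains to exclude that [psi] is zero or that [phi] is a constant [b].  In
    both cases the kernel of [T] contains every polynomial vanishing at some
    point [b], so it is infinite-dimensional.  A Fredholm operator has a
    finite-dimensional kernel, since the compact remainder is [- 1] there
    ([fredholm_kernel_finite], [fredholm_no_point_kernel]). *)

(** * Solving linear equations by Neumann iteration *)

(** A complex number comparable with [0] is real, so this is a statement about
    real numbers. *)
Lemma expr_lt_eps (R : realType) (q e : R[i]) :
  0 <= q < 1 -> 0 < e -> exists n, q ^+ n < e.
Proof.
case: q => q1 q2; case: e => e1 e2.
rewrite !lecE !ltcE /= => /andP[/andP[/eqP ->] q0 /andP[_ q1'] /andP[/eqP -> e0]].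
have qn1 : `|q1| < 1 by rewrite ger0_norm.
have /cvgr0_norm_lt/(_ _ e0)[N _ /(_ N (leqnn N)) /=] := cvg_expr qn1.
rewrite ger0_norm ?exprn_ge0// => h.
by exists N; rewrite -[_ +i* _]/(q1%:C) -[_ +i* _]/(e1%:C) -rmorphXn ltcR.
Qed.

(** The equation reads [x = y + B x], and the right-hand side is a strict
    contraction; its iterates from [0] are the partial sums of the Neumann
    series. *)
Lemma neumann_solve (R : realType) (V : completeNormedModType R[i])
    (B : {linear V -> V}) (q : R[i]) (q01 : 0 <= q < 1)
    (Bq : forall x, `|B x| <= q * `|x|) (y : V) : exists x, x - B x = y.
Proof.
have /andP[q0 q1] := q01.
have q1' : 0 < 1 - q by rewrite subr_gt0.
pose s n := iter n (fun x => y + B x) 0.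
(* [C] solves [C = |y| + q C], so it bounds all iterates. *)
pose C := `|y| / (1 - q).
have C0 : 0 <= C by rewrite divr_ge0 // ltW.
have sC m : `|s m| <= C.
  elim: m => [|m IH]; first by rewrite /s /= normr0.
  rewrite /= (le_trans (ler_normD _ _))//.
  have -> : C = `|y| + q * C by rewrite /C; field; rewrite gt_eqF.
  by rewrite lerD2l (le_trans (Bq _))// ler_wpM2l.
have sB n m : `|s (n + m)%N - s n| <= q ^+ n * C.
  elim: n => [|n IH]; first by rewrite add0n (_ : s 0%N = 0) // subr0 expr0 mul1r.
  rewrite addSn /= opprD addrACA subrr add0r -raddfB exprS -mulrA.
  by rewrite (le_trans (Bq _))// ler_wpM2l.
have small (e : R[i]) : 0 < e -> exists n, q ^+ n * C < e.
  move=> e0; have C1 : 0 < C + 1 by rewrite ltr_wpDl.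
  have [n qn] := expr_lt_eps q01 (divr_gt0 e0 C1).
  exists n; rewrite ltr_pdivlMr// in qn; apply: le_lt_trans qn.
  by rewrite ler_wpM2l ?exprn_ge0// lerDl.
have /cauchy_cvg /cvg_ex[x sx] : cauchy (s @ \oo).
  apply: cauchy_exP => e e0; have [n ne] := small _ e0.
  exists (s n); exists n => // m /= nm.
  rewrite -ball_normE /= distrC -(subnKC nm).
  exact: le_lt_trans (sB _ _) ne.
exists x; apply/eqP; rewrite -subr_eq0 -normr_le0.
apply/ler_addgt0Pl => e e0; rewrite addr0.
have e2 : 0 < e / 2 by rewrite divr_gt0.
have /cvgrPdist_le /(_ _ e2) [N _ Ns] := sx.
have h1 := Ns N (leqnn N); have h2 := Ns N.+1 (leqnSn N).
have -> : x - B x - y = (x - s N.+1) - B (x - s N).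
  by rewrite raddfB /=; rewrite opprB opprD !addrA subrK (addrAC _ (- y)).
rewrite (le_trans (ler_normB _ _))// (splitr e) lerD//.
by rewrite (le_trans (Bq _))// -[leRHS]mul1r ler_pM// ltW.
Qed.

(** * Normal operators that are bounded below *)

Lemma bounded_operator_gt0 (R : realType) (H : analytic_hilbert_space R)
    (T : {linear H -> H}) :
  bounded_operator T -> exists2 M, 0 < M & forall h, `|T h| <= M * `|h|.
Proof.
move=> [M TM]; exists (`|M| + 1) => [|h]; first by rewrite ltr_wpDl.
have Mh : 0 <= M * `|h| := le_trans (normr_ge0 _) (TM h).
rewrite (le_trans (TM h))// -(ger0_norm Mh) normrM normr_id.
by rewrite ler_wpM2r// lerDl.
Qed.

(** With [t = c / M^2], expanding [|x - t A x|^2] and using coercivity gives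
    at most [(1 - (c / M)^2) |x|^2], so [1 - t A] is a strict contraction and
    [t A x = t y] can be solved by Neumann iteration. *)
Lemma coercive_onto (R : realType) (H : analytic_hilbert_space R)
    (A : {linear H -> H}) (c M : R[i]) (c0 : 0 < c) (cM : c <= M)
    (AM : forall x, `|A x| <= M * `|x|)
    (Ac : forall x, c * `|x| ^+ 2 <= dot H x (A x)) (y : H) :
  exists x, A x = y.
Proof.
have M0 : 0 < M := lt_le_trans c0 cM.
(* [t] minimizes the bound [1 - 2 t c + t^2 M^2], whose minimum is [1 - e]. *)
pose t := c / M ^+ 2; have t0 : 0 < t by rewrite divr_gt0 ?exprn_gt0.
pose e := (c / M) ^+ 2.
have e0 : 0 < e by rewrite exprn_gt0 ?divr_gt0.
have e1 : e <= 1.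
  have cM1 : c / M <= 1 by rewrite ler_pdivrMr// mul1r.
  by apply: exprn_ile1 => //; rewrite divr_ge0 ?ltW.
(* A rational substitute for the square root of [1 - e]. *)
pose q := 1 - e / 2.
have q0 : 0 <= q.
  by rewrite subr_ge0 ler_pdivrMr// mul1r (le_trans e1)// ler1n.
have q1 : q < 1 by rewrite gtrBl divr_gt0.
have contr x : `|(idfun \- (t \*: A)) x| <= q * `|x|.
  rewrite -(@ler_pXn2r _ 2)// ?nnegrE ?mulr_ge0// dotE /= dnormB -!dotE.
  rewrite linearZr_LR /=.
  have tr : Num.conj t = t by apply/CrealP; exact: gtr0_real.
  rewrite tr.
  have d0 : 0 <= dot H x (A x).
    by apply: le_trans (Ac x); rewrite mulr_ge0 ?exprn_ge0 // ltW.
  have -> : Num.conj (t * dot H x (A x)) = t * dot H x (A x).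
    by apply/CrealP; rewrite ger0_real// mulr_ge0// ltW.
  apply: (@le_trans _ _ ((1 - e) * `|x| ^+ 2)); last first.
    rewrite exprMn ler_wpM2r ?exprn_ge0//.
    have -> : q ^+ 2 = 1 - e + (e / 2) ^+ 2 by rewrite /q; field.
    by rewrite lerDl exprn_ge0// divr_ge0// ltW.
  have -> : (1 - e) * `|x| ^+ 2 =
      `|x| ^+ 2 + (t * (M * `|x|)) ^+ 2 - (t * (c * `|x| ^+ 2) *+ 2).
    by rewrite /e /t; field; rewrite gt_eqF.
  rewrite -addrA -[leRHS]addrA lerD2l lerB//; last first.
    by rewrite -mulr2n lerMn2r /= ler_wpM2l// ltW.
  have tge0 := ltW t0; have Mx : 0 <= M * `|x| by rewrite mulr_ge0// ltW.
  rewrite normrZ gtr0_norm// ler_pXn2r ?nnegrE //; try exact: mulr_ge0.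
  by rewrite ler_wpM2l// ltW.
have q01 : 0 <= q < 1 by rewrite q0 q1.
have [x xE] := neumann_solve q01 contr (t *: y).
exists x; move: xE => /= /eqP; rewrite opprB addrC subrK => /eqP.
by apply: scalerI; rewrite gt_eqF.
Qed.

(** [S \o T] is coercive, hence onto; normality turns this into surjectivity of
    [T]. *)
Lemma bounded_below_invertible (R : realType) (H : analytic_hilbert_space R)
    (T : {linear H -> H}) :
  normal_operator T -> bounded_below T -> invertible T.
Proof.
move=> [Tb [S [Sb [adj TS]]]] [c [c0 Tc]].
have [M M0 TM] := bounded_operator_gt0 Tb.
have [N N0 SN] := bounded_operator_gt0 Sb.
have c20 : 0 < c ^+ 2 by rewrite exprn_gt0.
have NM0 : 0 < N * M by rewrite mulr_gt0.
have solve y : exists x, T x = y.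
  have cle : c ^+ 2 <= N * M + c ^+ 2 by rewrite lerDr ltW.
  have Ab x : `|(S \o T) x| <= (N * M + c ^+ 2) * `|x|.
    rewrite /= (le_trans (SN _))// mulrDl -mulrA.
    rewrite (@le_trans _ _ (N * (M * `|x|)))//; first by rewrite ler_wpM2l// ltW.
    by rewrite lerDl mulr_ge0// ltW.
  have Ac x : c ^+ 2 * `|x| ^+ 2 <= dot H x ((S \o T) x).
    have cx : 0 <= c * `|x| by rewrite mulr_ge0// ltW.
    by rewrite /= -adj -dotE -exprMn ler_pXn2r ?nnegrE.
  have [x <-] := coercive_onto c20 cle Ab Ac y.
  by exists (S x); rewrite TS.
pose U y := projT1 (cid (solve y)).
have UK : cancel U T by move=> y; rewrite /U; case: cid.
have Tinj : injective T.
  move=> x y xy; apply/eqP; rewrite -subr_eq0 -normr_le0.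
  by rewrite -(pmulr_rle0 _ c0) (le_trans (Tc _))// raddfB /= xy subrr normr0.
have Ulin : linear U by move=> a x y; apply: Tinj; rewrite linearP !UK.
pose UL : {linear H -> H} := HB.pack U (GRing.isLinear.Build _ _ _ _ U Ulin).
exists UL; split; last by split=> // x; apply: Tinj; rewrite UK.
exists c^-1 => h; rewrite -ler_pdivrMl ?invr_gt0// invrK.
by rewrite -{2}(UK h) Tc.
Qed.

Lemma invertible_fredholm (R : realType) (H : analytic_hilbert_space R)
    (T : {linear H -> H}) : invertible T -> fredholm T.
Proof.
have c0 (K : {linear H -> H}) : (forall h, K h = 0) -> compact_operator K.
  move=> K0; rewrite /compact_operator.
  have -> : [set K h | h in [set h : H | `|h| <= 1]] = [set 0].
    apply/seteqP; split => [_ [h _ <-]|_ ->]; first exact: K0.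
    by exists 0 => /=; rewrite ?normr0// K0.
  rewrite -(closure_id _).1; first exact: compact_set1.
  apply: compact_closed; [exact: norm_hausdorff|exact: compact_set1].
move=> [S [Sb [TS ST]]]; exists S; split=> //.
by split; apply: c0 => h /=; rewrite ?TS ?ST subrr.
Qed.

(** * Consequences of compactness of the remainders *)

(** If [T] is not bounded below, there are unit vectors [u n] with [T (u n)]
    tending to [0].  For the compact remainder [K = S \o T - 1], the sequence
    [K (u n)] has a cluster point [p]; as [S (T (u n))] tends to [0], [- p] is a
    cluster point of [u], so [p] is nonzero while [T p = 0]. *)
Lemma fredholm_injective_bounded_below (R : realType)
    (H : analytic_hilbert_space R) (T : {linear H -> H}) :
  bounded_operator T -> (forall h, T h = 0 -> h = 0) -> fredholm T ->
  bounded_below T.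
Proof.
move=> Tb Tinj [S [Sb [Kc _]]]; apply: contrapT => Tnb.
have [M M0 TM] := bounded_operator_gt0 Tb.
have [N N0 SN] := bounded_operator_gt0 Sb.
have half0 : 0 < 2^-1 :> R[i] by rewrite invr_gt0.
have half01 : 0 <= (2^-1 : R[i]) < 1 by rewrite ltW//= invf_lt1// ltr1n.
have unit_seq n : exists u : H, `|u| = 1 /\ `|T u| < 2^-1 ^+ n.
  apply: contrapT => nu; apply: Tnb; exists (2^-1 ^+ n); split.
    by rewrite exprn_gt0.
  move=> h; have cr : 2^-1 ^+ n * `|h| \is Num.real.
    by rewrite ger0_real// mulr_ge0// exprn_ge0// ltW.
  rewrite real_leNgt ?normr_real//.
  apply/negP => Th; apply: nu; exists (`|h|^-1 *: h).
  have h0 : 0 < `|h|.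
    rewrite normr_gt0; apply: contraTneq Th => ->.
    by rewrite raddf0 !normr0 mulr0 ltxx.
  rewrite linearZ /= !normrZ normfV normr_id mulVf ?gt_eqF//; split=> //.
  by rewrite mulrC ltr_pdivrMr.
pose u n := projT1 (cid (unit_seq n)).
have u1 n : `|u n| = 1 by rewrite /u; case: cid => x [].
have Tu n : `|T (u n)| < 2^-1 ^+ n by rewrite /u; case: cid => x [].
pose K := S \o T \- idfun.
have [|p [_ clp]] := Kc ((K \o u) @ \oo) _.
  exists 0%N => // n _; apply: subset_closure; exists (u n) => //=.
  by rewrite u1.
have near_p e : 0 < e -> exists2 n, `|T (u n)| <= e & `|p + u n| <= (N + 1) * e.
  move=> e0; have [n ne] := expr_lt_eps half01 e0.
  have FA : ((K \o u) @ \oo) ((K \o u) @` [set m | (n <= m)%N]).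
    by exists n => // m nm; exists m.
  have [_ [[m nm <-] /=]] := clp _ _ FA (nbhsx_ballx p e e0).
  rewrite -ball_normE /= => pm.
  have Tm : `|T (u m)| <= e.
    rewrite (le_trans (ltW (Tu m)))// (le_trans _ (ltW ne))//.
    by apply: ler_wiXn2l => //; case/andP: half01 => // _ /ltW.
  exists m => //.
  have -> : p + u m = S (T (u m)) + (p - (S (T (u m)) - u m)).
    by rewrite opprB addrCA [S _ + _]addrC subrK.
  rewrite (le_trans (ler_normD _ _))// mulrDl mul1r lerD//; last exact: ltW.
  by rewrite (le_trans (SN _))// ler_wpM2l// ltW.
have N1 : 0 < N + 1 by rewrite addr_gt0.
have p0 : p != 0.
  apply/eqP => p0; have e0 : 0 < 2^-1 / (N + 1) by rewrite divr_gt0.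
  have [n _] := near_p _ e0.
  rewrite p0 add0r u1 mulrC divfK ?gt_eqF// => h.
  by have := le_lt_trans h (andP half01).2; rewrite ltxx.
move/eqP: p0; apply; apply: Tinj; apply/eqP; rewrite -normr_le0.
apply/ler_addgt0Pl => e e0; rewrite addr0.
have L0 : 0 < M * (N + 1) + 1 by rewrite addr_gt0// mulr_gt0.
have [n Tn pn] := near_p _ (divr_gt0 e0 L0).
have -> : T p = T (p + u n) - T (u n) by rewrite raddfD addrK.
rewrite (le_trans (ler_normB _ _))//.
rewrite -[leRHS](divfK (lt0r_neq0 L0)) mulrC mulrDl mul1r lerD//.
by rewrite (le_trans (TM _))// -mulrA ler_wpM2l// ltW.
Qed.

(** Orthogonality to the vectors of [s] is a homogeneous linear system with more
    unknowns than equations. *)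
Lemma exists_orthogonal_combination (R : realType)
    (H : analytic_hilbert_space R) (a : nat -> H) (s : seq H) :
  exists2 c : 'rV[R[i]]_(size s).+1, c != 0 &
    forall x, x \in s -> dot H (\sum_i c 0 i *: a i) x = 0.
Proof.
pose G : 'M[R[i]]_((size s).+1, size s) :=
  \matrix_(i, j) dot H (a i) (tnth (in_tuple s) j).
have : kermx G != 0.
  by rewrite -mxrank_eq0 mxrank_ker -lt0n subn_gt0 ltnS rank_leq_col.
move=> /rowV0Pn[c /sub_kermxP cG c0]; exists c => // x xs.
have /tnthP[j ->] : x \in in_tuple s by [].
have /matrixP/(_ 0 j) := cG; rewrite linear_sumlz !mxE => cGj.
apply: etrans cGj; apply: eq_bigr => i _.
by rewrite linearZl_LR mxE.
Qed.

(** On the kernel of [T] the compact remainder is [- 1], so finitely many unit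
    balls cover the unit sphere of the kernel.  A unit vector [w] of the kernel
    orthogonal to all their centres [x] contradicts this, as
    [|x + w|^2 = |x|^2 + 1]. *)
Lemma fredholm_kernel_finite (R : realType) (H : analytic_hilbert_space R)
    (T : {linear H -> H}) (a : nat -> H) :
  fredholm T -> (forall i, T (a i) = 0) ->
  exists n (c : 'rV[R[i]]_n), c != 0 /\ \sum_i c 0 i *: a i = 0.
Proof.
move=> [S [_ [Kc _]]] Ta; apply: contrapT => indep.
move: Kc; rewrite /compact_operator compact_cover => Kc.
have [||D _ cov] := Kc H setT (fun x => ball x 1).
- by move=> x _; exact: ball_open.
- by move=> x _; exists x => //; exact: ballxx.
have [c c0 orth] := exists_orthogonal_combination a (finmap.enum_fset D).
set v := \sum_i _ in orth.
have v0 : v != 0 by apply/eqP => v0; apply: indep; exists _, c.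
have Tv : T v = 0.
  by rewrite linear_sum big1//= => i _; rewrite linearZ /= Ta scaler0.
pose w := `|v|^-1 *: v.
have w1 : `|w| = 1 by rewrite normrZ normfV normr_id mulVf// normr_eq0.
have : closure [set (S \o T \- idfun) h | h in [set h : H | `|h| <= 1]] (- w).
  apply: subset_closure; exists w => /=; first by rewrite w1.
  by rewrite linearZ /= Tv scaler0 raddf0 sub0r.
move=> /cov[x /= xD]; rewrite -ball_normE /= opprK => xw.
suff : 1 <= `|x + w| by move=> /le_lt_trans/(_ xw); rewrite ltxx.
rewrite -(@ler_pXn2r _ 2)// ?nnegrE// expr1n dotE addrC hnormDd.
  by rewrite /= -!dotE w1 expr1n lerDl exprn_ge0.
by rewrite linearZl_LR /= orth// mulr0.
Qed.

(** * Power series *)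

(** Substitute for the minimum, which need not exist for the partial order of
    complex numbers. *)
Lemma common_radius (K : numFieldType) (a b : K) : 0 < a -> 0 < b ->
  exists2 d, 0 < d & d <= a /\ d <= b.
Proof.
move=> a0 b0; have ab0 : 0 < a + b by rewrite addr_gt0.
exists (a * b / (a + b)); first by rewrite divr_gt0// mulr_gt0.
split; rewrite ler_pdivrMr//.
  by rewrite ler_wpM2l ?lerDr// ltW.
by rewrite mulrC ler_wpM2l ?lerDl// ltW.
Qed.

Lemma lim_dist_le (K : numFieldType) (V : normedModType K) (u : nat -> V)
    (l b : V) (C : K) :
  u @ \oo --> l -> (forall n, `|u n.+1 - b| <= C) -> `|l - b| <= C.
Proof.
move=> ul ub; apply/ler_addgt0Pl => e e0.
have /cvgrPdist_le/(_ _ e0)[N _ /(_ N.+1 (leqnSn N)) uN] := ul.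
have -> : l - b = (l - u N.+1) + (u N.+1 - b) by rewrite addrA subrK.
by rewrite (le_trans (ler_normD _ _))// lerD.
Qed.

(** Induction by factoring out [x], as in the Horner scheme: this keeps the
    bound uniform in [N] without summing a geometric series. *)
Lemma power_sum_le (K : numFieldType) (b : nat -> K) (x y M : K) :
  y != 0 -> `|x| * 2 <= `|y| -> (forall n, `|b n| * `|y| ^+ n <= M) ->
  forall N, `|\sum_(0 <= n < N) b n * x ^+ n| <= M * 2.
Proof.
move=> y0 xy bM N; elim: N b M bM => [|N IH] b M bM.
  rewrite big_geq// normr0 mulr_ge0//.
  by apply: le_trans (bM 0%N); rewrite mulr_ge0.
have ny : 0 < `|y| by rewrite normr_gt0.
rewrite big_nat_recl// expr0 mulr1.
under eq_bigr do rewrite exprS mulrCA.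
rewrite -mulr_sumr (le_trans (ler_normD _ _))// mulr_natr mulr2n lerD//.
  by have := bM 0%N; rewrite expr0 mulr1.
have shift n : `|b n.+1| * `|y| ^+ n <= M / `|y|.
  by rewrite ler_pdivlMr// -mulrA -exprSr.
rewrite normrM (le_trans (ler_wpM2l (normr_ge0 x) (IH _ _ shift)))//.
have -> : `|x| * (M / `|y| * 2) = M * (`|x| * 2 / `|y|).
  by field; rewrite gt_eqF.
rewrite ler_piMr//.
  by apply: le_trans (bM 0%N); rewrite mulr_ge0.
by rewrite ler_pdivrMr// mul1r.
Qed.

Lemma power_sum_sub_head_le (K : numFieldType) (a : nat -> K) (x y M : K) :
  y != 0 -> `|x| * 2 <= `|y| -> (forall n, `|a n| * `|y| ^+ n <= M) ->
  forall N, `|\sum_(0 <= n < N.+1) a n * x ^+ n - a 0%N| <=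
    `|x| * (M / `|y| * 2).
Proof.
move=> y0 xy aM N; have ny : 0 < `|y| by rewrite normr_gt0.
rewrite big_nat_recl// expr0 mulr1 addrC addKr.
under eq_bigr do rewrite exprS mulrCA.
rewrite -mulr_sumr normrM ler_wpM2l//.
apply: (@power_sum_le _ (fun n => a n.+1) _ y) => // n.
by rewrite ler_pdivlMr// -mulrA -exprSr.
Qed.

Lemma power_series_coef_bounded (K : numFieldType) (a : nat -> K) (y : K) :
  cvgn (fun N => \sum_(0 <= n < N) a n * y ^+ n : K^o) ->
  exists M, forall n, `|a n| * `|y| ^+ n <= M.
Proof.
move=> /cvg_seq_bounded/pinfty_ex_gt0[B _ hB].
exists (B + B) => n; rewrite -normrX -normrM.
have -> : a n * y ^+ n =
    \sum_(0 <= i < n.+1) a i * y ^+ i - \sum_(0 <= i < n) a i * y ^+ i.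
  by rewrite big_nat_recr//= addrAC subrr add0r.
by rewrite (le_trans (ler_normB _ _))// lerD// hB.
Qed.

(** The sum of a power series is continuous at [0], uniformly along its partial
    sums, which spares any manipulation of limits of tails. *)
Lemma power_series_near_head (K : numFieldType) (a : nat -> K) (y M e : K) :
  y != 0 -> (forall n, `|a n| * `|y| ^+ n <= M) -> 0 < e ->
  exists2 d, 0 < d & forall x, `|x| < d ->
    forall N, `|\sum_(0 <= n < N.+1) a n * x ^+ n - a 0%N| <= e.
Proof.
move=> y0 aM e0; have ny : 0 < `|y| by rewrite normr_gt0.
have M0 : 0 <= M by apply: le_trans (aM 0%N); rewrite mulr_ge0.
pose C := M / `|y| * 2 + 1.
have C0 : 0 < C by rewrite ltr_wpDl// mulr_ge0// divr_ge0// ltW.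
have [d d0 [dy de]] :=
  common_radius (divr_gt0 ny (ltr0Sn K 1)) (divr_gt0 e0 C0).
exists d => // x xd N.
have xy : `|x| * 2 <= `|y|.
  by rewrite -ler_pdivlMr// (le_trans (ltW xd)).
rewrite (le_trans (power_sum_sub_head_le y0 xy aM N))//.
rewrite (@le_trans _ _ (`|x| * C))//; first by rewrite ler_wpM2l// lerDl.
by rewrite -ler_pdivlMr// (le_trans (ltW xd)).
Qed.

(** If [k] is the index of the first nonzero coefficient, the partial sums are
    [x^k] times those of a power series whose constant term is [a k], so near
    [0] they have modulus at least [|x|^k |a k| / 2]. *)
Lemma power_series_isolated_zero (K : numFieldType) (a : nat -> K)
    (y M : K) (k : nat) :
  y != 0 -> (forall n, `|a n| * `|y| ^+ n <= M) -> a k != 0 ->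
  exists2 d, 0 < d & forall x l, 0 < `|x| < d ->
    (fun N => \sum_(0 <= n < N) a n * x ^+ n : K^o) @ \oo --> (l : K^o) ->
    l != 0.
Proof.
move=> y0 aM ak0.
have [{ak0}k ak kmin] := ex_minnP (ex_intro (fun n => a n != 0) k ak0).
have nak : 0 < `|a k| by rewrite normr_gt0.
pose b n := a (n + k)%N.
have bM n : `|b n| * `|y| ^+ n <= M / `|y| ^+ k.
  rewrite ler_pdivlMr ?exprn_gt0 ?normr_gt0// -mulrA -exprD; exact: aM.
have [d d0 db] := power_series_near_head y0 bM (divr_gt0 nak (ltr0Sn K 1)).
exists d => // x l /andP[x0 xd] al.
have low N : `|x| ^+ k * (`|a k| / 2) <=
    `|\sum_(0 <= n < (N.+1 + k)) a n * x ^+ n|.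
  have -> : \sum_(0 <= n < (N.+1 + k)) a n * x ^+ n =
      x ^+ k * \sum_(0 <= n < N.+1) b n * x ^+ n.
    rewrite (@big_cat_nat _ _ _ k)//= ?leq_addl//.
    rewrite big_nat big1 ?add0r; last first.
      move=> n /andP[_ nk]; have [->|/kmin] := eqVneq (a n) 0.
        by rewrite mul0r.
      by rewrite leqNgt nk.
    rewrite -{1}[k]add0n big_addn addnK mulr_sumr; apply: eq_bigr => n _.
    by rewrite /b exprD mulrA mulrC.
  rewrite normrM normrX ler_wpM2l ?exprn_ge0//.
  have := db x xd N; set s := \sum_(_ <= _ < _) _; rewrite distrC => sb.
  have := ler_normD (b 0%N - s) s; rewrite subrK {1}/b add0n -lerBlDl.
  apply: le_trans; rewrite {2}(splitr `|a k|) lerBrDl.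
  by rewrite lerD2r.
apply/eqP => l0; move: al; rewrite l0 => /cvgr0_norm_lt.
have low0 : 0 < `|x| ^+ k * (`|a k| / 2).
  by rewrite mulr_gt0 ?exprn_gt0 ?divr_gt0.
move=> /(_ _ low0)[N _ /(_ (N.+1 + k)%N)] /=.
rewrite addSnnS leq_addr => /(_ isT); rewrite -addSnnS.
by move=> /(le_lt_trans (low N)); rewrite ltxx.
Qed.

(** * Analytic functions on the disk *)

Lemma disk_point (R : realType) (w : disk R) (d : R[i]) :
  `|d| < 1 - `|val w| -> exists z : disk R, val z = val w + d.
Proof.
move=> dw; have h : `|val w + d| < 1.
  by rewrite (le_lt_trans (ler_normD _ _))// addrC -ltrBrDr.
by exists (exist (fun z => is_true (`|z| < 1)) _ h).
Qed.

Definition vanishes_near (R : realType) (f : disk R -> R[i]) (w : disk R) :=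
  exists2 r : R[i], 0 < r &
    forall z : disk R, `|val z - val w| < r -> f z = 0.

(** The quantitative form in which analyticity is used: convergence at a
    single point [w + y] of the disk gives the Abel bound on the
    coefficients. *)
Lemma analytic_coef_bounded (R : realType) (f : disk R -> R[i]) (w : disk R) :
  analytic f -> exists (a : nat -> R[i]) (r y M : R[i]),
  [/\ 0 < r, y != 0, forall n, `|a n| * `|y| ^+ n <= M &
    forall z : disk R, `|val z - val w| < r ->
      (fun N => \sum_(0 <= n < N) a n * (val z - val w) ^+ n : R[i]^o) @ \oo
        --> (f z : R[i]^o)].
Proof.
move=> fa; destruct (fa w) as [a [r [r0 ar]]].
have w1 : 0 < 1 - `|val w| by rewrite subr_gt0; exact: (valP w).
have [d d0 [dr dw]] := common_radius r0 w1.
have dn : `|d / 2| < d.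
  by rewrite gtr0_norm ?divr_gt0// ltr_pdivrMr// ltr_pMr// ltr1n.
have [z zE] := disk_point (lt_le_trans dn dw).
have zw : val z - val w = d / 2 by rewrite zE addrAC subrr add0r.
have [|M aM] := @power_series_coef_bounded _ a (d / 2).
  apply/cvg_ex; exists (f z); rewrite -zw; apply: ar.
  by rewrite zw (lt_le_trans dn).
by exists a, r, (d / 2), M; split=> //; rewrite gt_eqF// divr_gt0.
Qed.

Lemma analytic_continuous (R : realType) (f : disk R -> R[i]) (w : disk R)
    (e : R[i]) : analytic f -> 0 < e ->
  exists2 r : R[i], 0 < r &
    forall z : disk R, `|val z - val w| < r -> `|f z - f w| <= e.
Proof.
move=> fa e0.
destruct (analytic_coef_bounded w fa) as [a [r [y [M [r0 y0 aM ar]]]]].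
have fw : f w = a 0%N.
  have w0 : `|val w - val w| < r by rewrite subrr normr0.
  apply/eqP; rewrite -subr_eq0 -normr_le0.
  apply: (lim_dist_le (ar _ w0)) => N.
  rewrite big_nat_recl// expr0 mulr1 subrr big1 ?addr0 ?subrr ?normr0// => n _.
  by rewrite expr0n mulr0.
have [d1 d10 da] := power_series_near_head y0 aM e0.
have [d d0 [dr dd1]] := common_radius r0 d10.
exists d => // z zd; rewrite fw.
apply: (lim_dist_le (ar z (lt_le_trans zd dr))).
exact: da (lt_le_trans zd dd1).
Qed.

(** Either all coefficients of the expansion at [w] are zero, or the first
    nonzero one dominates near [w]. *)
Lemma analytic_isolated_zeros (R : realType) (f : disk R -> R[i])
    (w : disk R) : analytic f ->
  vanishes_near f w \/
  exists2 r : R[i], 0 < r &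
    forall z : disk R, 0 < `|val z - val w| < r -> f z != 0.
Proof.
move=> fa.
destruct (analytic_coef_bounded w fa) as [a [r [y [M [r0 y0 aM ar]]]]].
have [[k ak]|a0] := pselect (exists n, a n != 0); last first.
  left; exists r => // z zr; apply/eqP; rewrite -normr_le0 -[f z]subr0.
  apply: (lim_dist_le (ar z zr)) => N.
  rewrite big1 ?subrr ?normr0// => n _.
  have [->|an] := eqVneq (a n) 0; first by rewrite mul0r.
  by exfalso; apply: a0; exists n.
right; have [d1 d10 da] := power_series_isolated_zero y0 aM ak.
have [d d0 [dr dd1]] := common_radius r0 d10.
exists d => // z /andP[z0 zd].
apply: da (ar z (lt_le_trans zd dr)).
by rewrite z0 (lt_le_trans zd dd1).
Qed.

Lemma pos_complex_real (R : realType) (e : R[i]) :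
  0 < e -> exists2 r : R, 0 < r & r%:C = e.
Proof.
by case: e => x y; rewrite ltcE /= => /andP[/eqP -> x0]; exists x.
Qed.

(** The real line is used to parametrize segments of the disk, so that the
    connectedness of [[0, 1]] can stand for that of the disk. *)
Lemma segment_preimage_open (R : realType) (w z : R[i])
    (X : disk R -> Prop) :
  (forall u, X u -> exists2 r : R[i], 0 < r &
     forall v, `|val v - val u| < r -> X v) ->
  open [set t : R | exists2 u, val u = w + t%:C * (z - w) & X u].
Proof.
move=> Xopen; rewrite openE => t [u ut Xu].
have [r r0 Xr] := Xopen u Xu.
have u1 : 0 < 1 - `|val u| by rewrite subr_gt0; exact: (valP u).
have [d d0 [dr d1]] := common_radius r0 u1.
have L0 : 0 < `|z - w| + 1 by rewrite ltr_wpDl.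
have [e e0 eE] := pos_complex_real (divr_gt0 d0 L0).
exists e => //= s; rewrite /ball /= distrC => st.
have dE : w + s%:C * (z - w) - val u = (s - t)%:C * (z - w).
  by rewrite ut raddfB /= mulrBl opprD addrACA subrr add0r.
have near : `|w + s%:C * (z - w) - val u| < d.
  rewrite dE normrM.
  have -> : `|(s - t)%:C| = `|s - t|%:C.
    by rewrite normc_def /= expr0n addr0 sqrtr_sqr.
  rewrite (@le_lt_trans _ _ (`|s - t|%:C * (`|z - w| + 1)))//.
    by rewrite ler_wpM2l ?lerDl// lecR.
  by rewrite -ltr_pdivlMr// -eE ltcR.
have [v vE] := disk_point (lt_le_trans near d1).
rewrite subrKC in vE.
exists v => //; apply: Xr; rewrite vE; exact: lt_le_trans near dr.
Qed.

Lemma vanishes_near_open (R : realType) (f : disk R -> R[i]) (u : disk R) :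
  vanishes_near f u -> exists2 r : R[i], 0 < r &
     forall v, `|val v - val u| < r -> vanishes_near f v.
Proof.
move=> [r r0 fr]; have r2 : 0 < r / 2 by rewrite divr_gt0.
exists (r / 2) => // v vu; exists (r / 2) => // z zv.
apply: fr; rewrite (splitr r) -(subrKA (val v)).
by rewrite (le_lt_trans (ler_normD _ _))// ltrD.
Qed.

(** By isolation of zeros, [f] is nonzero at the points close to [u] but
    different from it. *)
Lemma not_vanishes_near_open (R : realType) (f : disk R -> R[i])
    (u : disk R) :
  analytic f -> ~ vanishes_near f u -> exists2 r : R[i], 0 < r &
     forall v, `|val v - val u| < r -> ~ vanishes_near f v.
Proof.
move=> fa nu.
destruct (analytic_isolated_zeros u fa) as [fu|[r r0 fr]].
  by case: (nu fu).
exists r; first exact: r0.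
move=> v vu nv; destruct (eqVneq (val v) (val u)) as [vu0|vu0].
  by apply: nu; rewrite -(val_inj vu0).
have [s s0 /(_ v)] := nv; rewrite subrr normr0 => /(_ s0) /eqP.
by apply/negP/fr; rewrite vu normr_gt0 subr_eq0 vu0.
Qed.

Lemma unit_ball_segment (K : numFieldType) (t w z : K) :
  0 <= t <= 1 -> `|w| < 1 -> `|z| < 1 -> `|w + t * (z - w)| < 1.
Proof.
move=> /andP[t0 t1] w1 z1.
have -> : w + t * (z - w) = (1 - t) * w + t * z by ring.
rewrite (le_lt_trans (ler_normD _ _))// !normrM.
rewrite (ger0_norm t0) ger0_norm ?subr_ge0//.
have [->|tn] := eqVneq t 0; first by rewrite subr0 mul0r mul1r addr0.
have -> : ((1 - t) * `|w| + t * `|z| < 1) =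
    ((1 - t) * `|w| + t * `|z| < (1 - t) * 1 + t * 1).
  by rewrite !mulr1 subrK.
rewrite ler_ltD//; first by rewrite ler_wpM2l ?subr_ge0// ltW.
by rewrite ltr_pM2l// lt_def tn.
Qed.

(** Along the segment from [w] to [z], both the parameters near whose image [f]
    vanishes and the other ones form open sets; the segment being connected, the
    second set is empty. *)
Lemma identity_theorem (R : realType) (f : disk R -> R[i]) (w : disk R) :
  analytic f -> vanishes_near f w -> forall z, f z = 0.
Proof.
move=> fa fw z.
pose g (t : R) := val w + t%:C * (val z - val w).
pose P := [set t | exists2 u : disk R, val u = g t & vanishes_near f u].
pose Q := [set t | exists2 u : disk R, val u = g t & ~ vanishes_near f u].
have Po : open P by apply: segment_preimage_open => u; exact: vanishes_near_open.
have Qo : open Q.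
  by apply: segment_preimage_open => u; exact: not_vanishes_near_open.
have gdisk t : t \in `[0, 1] -> exists u : disk R, val u = g t.
  rewrite in_itv /= => /andP[t0 t1].
  have t01' : 0 <= (t%:C : R[i]) <= 1 by rewrite !lecR t0.
  have w1 : `|val w| < 1 := valP w.
  have z1 : `|val z| < 1 := valP z.
  have gt1 : `|g t| < 1 := unit_ball_segment t01' w1 z1.
  by exists (exist (fun z => is_true (`|z| < 1)) _ gt1).
pose I01 : set R := [set` `[0, 1]].
have I0 : I01 0 by rewrite /I01 /= in_itv /= lexx ler01.
have I1 : I01 1 by rewrite /I01 /= in_itv /= ler01 lexx.
have PE : I01 `&` P = I01.
  apply: (@segment_connected R 0 1).
  - exists 0; split=> //.
    by exists w => //; rewrite /g mul0r addr0.
  - by exists P.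
  - exists (~` Q); first exact: open_closedC.
    apply/seteqP; split => t [t01].
      move=> [u ut uv]; split=> // -[v vt]; apply.
      by rewrite (val_inj (etrans vt (esym ut))).
    move=> nQ; split=> //; have [u ut] := gdisk _ t01.
    exists u => //; apply: contrapT => nu; apply: nQ; exists u => //.
have : (I01 `&` P) 1 by rewrite PE.
move=> [_ [u]]; rewrite /g mul1r subrKC => /val_inj -> [r r0]; apply.
by rewrite subrr normr0.
Qed.

Lemma power_series_sub_const (K : numFieldType) (a : nat -> K) (x l b : K) :
  (fun N => \sum_(0 <= n < N) a n * x ^+ n : K^o) @ \oo --> (l : K^o) ->
  (fun N => \sum_(0 <= n < N) (if n is 0%N then a n - b else a n) * x ^+ n
    : K^o) @ \oo --> (l - b : K^o).
Proof.
move=> al; apply/cvgrPdist_lt => e e0.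
have /cvgrPdist_lt/(_ _ e0)[N _ aN] := al.
exists N.+1 => // -[//|n] /= Nn; have := aN n.+1 (leqW Nn).
rewrite !big_nat_recl// !expr0 !mulr1 => h.
by rewrite [a 0%N - b + _]addrAC opprB addrA subrK.
Qed.

Lemma analytic_sub_const (R : realType) (f : disk R -> R[i]) (b : R[i]) :
  analytic f -> analytic (fun z => f z - b).
Proof.
move=> fa w; destruct (fa w) as [a [r [r0 ar]]].
exists (fun n => if n is 0%N then a n - b else a n), r; split; first exact: r0.
by move=> z zr; exact: power_series_sub_const (ar z zr).
Qed.

(** Off the origin and near it, [psi] has no zero, so [phi] takes values in the
    zeros of [h]; being continuous, [phi] stays where the only possible zero of
    [h] is [phi 0].  Hence [phi] is locally constant there. *)
Lemma wcomp_eq0 (R : realType) (psi : disk R -> R[i])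
    (phi : disk R -> disk R) (h : disk R -> R[i]) :
  analytic psi -> analytic (fun z => val (phi z)) -> analytic h ->
  (forall z, wcomp psi phi h z = 0) ->
  [\/ forall z, psi z = 0, exists b, forall z, phi z = b | forall z, h z = 0].
Proof.
move=> psia phia ha comp0.
have o1 : `|0 : R[i]| < 1 by rewrite normr0 ltr01.
pose o : disk R := exist (fun z => is_true (`|z| < 1)) _ o1.
destruct (analytic_isolated_zeros o psia) as [psi0|[r r0 psin]].
  by apply: Or31; exact: identity_theorem psi0.
destruct (analytic_isolated_zeros (phi o) ha) as [h0|[s s0 hn]].
  by apply: Or33; exact: identity_theorem h0.
have [d d0 cphi] := analytic_continuous o phia (divr_gt0 s0 (ltr0Sn _ 1)).
have ss : s / 2 < s by rewrite ltr_pdivrMr// ltr_pMr// ltr1n.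
have [e e0 [er ed]] := common_radius r0 d0.
have phisub := analytic_sub_const (val (phi o)) phia.
have phi_const (z : disk R) : `|val z - val o| < e -> val (phi z) - val (phi o) = 0.
  move=> ze; destruct (eqVneq (val z) (val o)) as [zo|zo].
    by rewrite (val_inj zo) subrr.
  have /eqP := comp0 z; rewrite mulf_eq0 (negPf (psin z _)) /=; last first.
    by rewrite (lt_le_trans ze er) andbT normr_gt0 subr_eq0 zo.
  move=> hz; apply/eqP; apply: contraLR hz => phiz; apply: hn.
  by rewrite normr_gt0 phiz (le_lt_trans (cphi z (lt_le_trans ze ed))).
apply: Or32; exists (phi o) => z; apply: val_inj; apply/eqP.
rewrite -subr_eq0; apply/eqP; move: z.
by apply: (identity_theorem (w := o) phisub); exists e.
Qed.

(** * Weighted composition operators *)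

(** The disk contains infinitely many points, for instance the [1 / (n + 2)]. *)
Lemma poly_eq0_of_disk (R : realType) (p : {poly R[i]}) :
  (forall z : disk R, p.[val z] = 0) -> p = 0.
Proof.
move=> pz; apply: contrapT => /eqP p0.
pose rs : seq R[i] := [seq (n.+2)%:R^-1 | n <- iota 0 (size p)].
have : (size rs < size p)%N.
  apply: max_poly_roots p0 _ _.
    apply/allP => _ /mapP[n _ ->]; apply/rootP.
    have n1 : `|(n.+2)%:R^-1 : R[i]| < 1.
      by rewrite ger0_norm ?invr_ge0// invf_lt1// ltr1n.
    exact: (pz (exist (fun z => is_true (`|z| < 1)) _ n1)).
  rewrite map_inj_uniq ?iota_uniq// => m n /invr_inj /eqP.
  by rewrite eqr_nat => /eqP [].
by rewrite size_map size_iota ltnn.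
Qed.

(** The kernel would contain the independent vectors [(X - b) X^i]. *)
Lemma fredholm_no_point_kernel (R : realType) (H : analytic_hilbert_space R)
    (T : {linear H -> H}) (b : disk R) :
  contains_polynomials H -> fredholm T ->
  ~ (forall h : H, ev H h b = 0 -> T h = 0).
Proof.
move=> Hp Tf Tb.
pose q i : {poly R[i]} := ('X - (val b)%:P) * 'X^i.
pose a i := projT1 (cid (Hp (q i))).
have aE i : ev H (a i) = (fun z => (q i).[val z]) by rewrite /a; case: cid.
have Ta i : T (a i) = 0.
  by apply: Tb; rewrite aE /q hornerM !hornerE subrr mul0r.
have [n [c [c0 sum0]]] := fredholm_kernel_finite Tf Ta.
pose p : {poly R[i]} := \sum_(i < n) c 0 i *: 'X^i.
have : ('X - (val b)%:P) * p = 0.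
  apply: poly_eq0_of_disk => z.
  have := congr1 (fun h => ev H h z) sum0.
  rewrite /= linear0 linear_sum /= fct_sumE => s0.
  apply: etrans s0.
  rewrite mulr_sumr horner_sum; apply: eq_bigr => i _.
  by rewrite linearZ /= fctE aE -scalerAr hornerZ.
move/eqP; rewrite mulf_eq0 polyXsubC_eq0 /= => /eqP p0.
move/eqP: c0; apply; apply/rowP => j.
have := congr1 (fun r : {poly R[i]} => r`_j) p0.
rewrite coef0 coef_sum mxE (bigD1 j)//= coefZ coefXn eqxx mulr1 big1 ?addr0//.
move=> i ij; rewrite coefZ coefXn eq_sym (inj_eq val_inj) (negPf ij).
exact: mulr0.
Qed.

(** If [psi = 0] or [phi] is a constant [b], then [T h] depends only on the value
    of [h] at one point, which a Fredholm operator on a space containing the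
    polynomials cannot do. *)
Lemma fredholm_wcomp_injective (R : realType) (H : analytic_hilbert_space R)
    (psi : disk R -> R[i]) (phi : disk R -> disk R) (T : {linear H -> H}) :
  contains_polynomials H -> analytic psi -> analytic (fun z => val (phi z)) ->
  is_wcomp psi phi T -> fredholm T -> forall h, T h = 0 -> h = 0.
Proof.
move=> Hp psia phia TE Tf h Th.
have comp0 z : wcomp psi phi (ev H h) z = 0 by rewrite -TE Th linear0.
have eq0 (g : H) : (forall z, ev H g z = 0) -> g = 0.
  by move=> g0; apply: (@ev_inj _ H); rewrite linear0; apply/funext.
have o1 : `|0 : R[i]| < 1 by rewrite normr0 ltr01.
destruct (wcomp_eq0 psia phia (@ev_analytic _ H h) comp0)
  as [psi0|[b phib]|h0]; last exact: eq0.
- exfalso.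
  apply: (@fredholm_no_point_kernel _ _ _
    (exist (fun z => is_true (`|z| < 1)) _ o1) Hp Tf) => g _.
  by apply: eq0 => z; rewrite TE /wcomp psi0 mul0r.
- exfalso; apply: (@fredholm_no_point_kernel _ _ _ b Hp Tf) => g gb.
  by apply: eq0 => z; rewrite TE /wcomp phib gb mulr0.
Qed.

Theorem theorem4p8 (R : realType) (H : analytic_hilbert_space R)
    (hpoly : contains_polynomials H)
    (psi : disk R -> R[i]) (hpsi : analytic psi)
    (phi : disk R -> disk R) (hphi : analytic (fun z => val (phi z)))
    (T : {linear H -> H}) (hT : is_wcomp psi phi T)
    (hnormal : normal_operator T) :
  (bounded_below T <-> fredholm T) /\ (fredholm T <-> invertible T).
Proof.
have bi := bounded_below_invertible hnormal.
have fb : fredholm T -> bounded_below T.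
  move=> Tf; apply: (fredholm_injective_bounded_below hnormal.1 _ Tf).
  exact: fredholm_wcomp_injective hpoly hpsi hphi hT Tf.
split; split.
- by move=> /bi; exact: invertible_fredholm.
- exact: fb.
- by move=> /fb; exact: bi.
- exact: invertible_fredholm.
Qed.
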